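(* Let $p\in(0,1)$ be a constant and let $G_p$ be the random graph on $n$ vertices in which each edge is present independently with probability $p$. Let $q\ge 1$ and let $D_q$ be a $q\times q$ matrix whose entries are finite or co-finite subsets of $\mathbb{N}$. Then there is an algorithm that almost surely solves the $D_q$-problem on input $G_p$ in time $$O^*\left(2^{O(q\cdot d(D_q)\cdot\log^4 n)}\right),$$ where the constant hidden in the exponent does not depend on $q$, $D_q$ or $n$.
   Context: $\mathbb{N}=\{0,1,2,\dots\}$. A $D_q$-partition in a graph $G$ is a partition $\{V_1,V_2,\dots,V_q\}$ of $V(G)$ (classes may be empty) such that for all $1\le i,j\le q$ and all $v\in V_i$ we have $|N(v)\cap V_j|\in D_q[i,j]$, where $N(v)$ is the set of neighbors of $v$. The $D_q$-problem consists of deciding whether the input graph has a $D_q$-partition. For a finite or co-finite $\mu\subseteq\mathbb{N}$, set $d(\mathbb{N})=0$ and otherwise $d(\mu)=1+\min\{\max\{x\in\mathbb{N}: x\in\mu\},\ \max\{x\in\mathbb{N}: x\notin\mu\}\}$, where the maximum of an infinite set is $+\infty$ and the maximum of the empty set is $-1$. Let $d(D_q)=\max_{i,j} d(D_q[i,j])$. The notation $O^*(\cdot)$ suppresses factors polynomial in $n$. ''Almost surely'' means with probability tending to $1$ as $n\to\infty$ over the choice of $G_p$. *)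

(* Defs.v *)
From HB Require Import structures.
From mathcomp Require Import all_boot all_order all_algebra.
From mathcomp Require Import all_classical all_reals all_analysis.

Set Implicit Arguments.
Unset Strict Implicit.
Unset Printing Implicit Defensive.

Import Order.TTheory GRing.Theory Num.Theory.
Import numFieldNormedType.Exports.

Local Open Scope classical_set_scope.
Local Open Scope ring_scope.

Definition sgraph_axiom n (a : {ffun 'I_n * 'I_n -> bool}) : bool :=
  [forall u, ~~ a (u, u)] && [forall u, forall v, a (u, v) == a (v, u)].

Record sgraph n := SGraph {
  sgraph_val : {ffun 'I_n * 'I_n -> bool};
  _ : sgraph_axiom sgraph_val
}.

HB.instance Definition _ n := [isSub for @sgraph_val n].
HB.instance Definition _ n := [Finite of sgraph n by <:].

Definition adj n (G : sgraph n) : rel 'I_n := fun u v => sgraph_val G (u, v).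

Definition nbh n (G : sgraph n) (v : 'I_n) : {set 'I_n} := [set u | adj G v u]%SET.

(* Every unordered pair of vertices is listed once, as u < v. *)
Definition gnp (R : realType) (p : R) n (G : sgraph n) : R :=
  \prod_(e : 'I_n * 'I_n | (e.1 < e.2)%N) (if adj G e.1 e.2 then p else 1 - p).

Definition gnp_prob (R : realType) (p : R) n (E : sgraph n -> Prop) : R :=
  \sum_(G : sgraph n | `[< E G >]) gnp p G.

Definition fin_or_cofin (mu : set nat) : Prop :=
  finite_set mu \/ finite_set (~` mu).

Definition is_Dpartition q (D : 'M[set nat]_q) n (G : sgraph n)
    (V : 'I_q -> {set 'I_n}) : Prop :=
  [/\ (\bigcup_i V i)%SET = [set: 'I_n]%SET,
      forall i j, i != j -> [disjoint V i & V j]%B &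
      forall i j v, v \in V i -> D i j #|(nbh G v :&: V j)%SET| ].

Definition has_Dpartition q (D : 'M[set nat]_q) n (G : sgraph n) : Prop :=
  exists V : 'I_q -> {set 'I_n}, is_Dpartition D G V.

Definition setmax (A : set nat) : \bar int :=
  if `[< A = set0 >] then (-1)%:E
  else if `[< finite_set A >]
  then (Posz (xget 0%N [set m | A m /\ forall x, A x -> (x <= m)%N]))%:E
  else +oo%E.

(* When mu is finite or co-finite the extended integer below is finite and
   nonnegative, so that fine and absz lose nothing. *)
Definition dset (mu : set nat) : nat :=
  if `[< mu = setT >] then 0%N
  else absz (fine (1%:E + Order.min (setmax mu) (setmax (~` mu)))%E).

Definition dmx q (D : 'M[set nat]_q) : nat :=
  (\max_(i < q) \max_(j < q) dset (D i j))%N.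

(* Time is counted on a unit-cost random access machine over the natural
   numbers with structured control: registers, an indirectly addressed memory,
   addition and truncated subtraction.  Multiplication is not primitive, so
   that t steps are simulated by a Turing machine in time polynomial in t and
   the size of the input. *)
Inductive cmd : Type :=
| CSkip
| CConst of nat & nat
| CAdd of nat & nat & nat
| CSub of nat & nat & nat
| CLoad of nat & nat
| CStore of nat & nat
| CSeq of cmd & cmd
| CIf of nat & cmd & cmd
| CWhile of nat & cmd.

Record store := Store { reg : nat -> nat; heap : nat -> nat }.

Definition upd (f : nat -> nat) (x a : nat) : nat -> nat :=
  fun y => if y == x then a else f y.

Definition set_reg (s : store) (x a : nat) : store :=
  Store (upd (reg s) x a) (heap s).

Definition set_mem (s : store) (x a : nat) : store :=
  Store (reg s) (upd (heap s) x a).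

(* exec c s t s' : started in s, the program c halts in s' after t steps. *)
Inductive exec : cmd -> store -> nat -> store -> Prop :=
| exec_skip s : exec CSkip s 1%N s
| exec_const x a s : exec (CConst x a) s 1%N (set_reg s x a)
| exec_add x y z s : exec (CAdd x y z) s 1%N (set_reg s x (reg s y + reg s z)%N)
| exec_sub x y z s : exec (CSub x y z) s 1%N (set_reg s x (reg s y - reg s z)%N)
| exec_load x y s : exec (CLoad x y) s 1%N (set_reg s x (heap s (reg s y)))
| exec_store x y s : exec (CStore x y) s 1%N (set_mem s (reg s x) (reg s y))
| exec_seq c1 c2 s1 s2 s3 t1 t2 :
    exec c1 s1 t1 s2 -> exec c2 s2 t2 s3 -> exec (CSeq c1 c2) s1 (t1 + t2)%N s3
| exec_if_nz x c1 c2 s t s' :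
    reg s x != 0%N -> exec c1 s t s' -> exec (CIf x c1 c2) s t.+1 s'
| exec_if_z x c1 c2 s t s' :
    reg s x = 0%N -> exec c2 s t s' -> exec (CIf x c1 c2) s t.+1 s'
| exec_while_z x c s : reg s x = 0%N -> exec (CWhile x c) s 1%N s
| exec_while_nz x c s1 s2 s3 t1 t2 :
    reg s1 x != 0%N -> exec c s1 t1 s2 -> exec (CWhile x c) s2 t2 s3 ->
    exec (CWhile x c) s1 (t1 + t2).+1%N s3.

(* Register 0 holds the number of vertices, and memory cells 0, ..., n * n - 1
   hold the adjacency matrix row by row; everything else is 0. *)
Definition input n (G : sgraph n) : store :=
  Store (fun x => if x == 0%N then n else 0%N)
        (fun a => [exists u : 'I_n, [exists v : 'I_n,
                    (a == u * n + v)%N && adj G u v]] : nat).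

(* The answer is yes when register 0 is nonzero on halting. *)
Definition solves_within (R : realType) q (D : 'M[set nat]_q) (A : cmd)
    n (G : sgraph n) (T : R) : Prop :=
  exists t s, [/\ exec A (input G) t s,
                  t%:R <= T &
                  (reg s 0%N != 0%N) <-> has_Dpartition D G].

Definition almost_surely_solves (R : realType) (p : R) q (D : 'M[set nat]_q)
    (A : cmd) (T : nat -> R) : Prop :=
  (fun n => gnp_prob p (fun G : sgraph n => solves_within D A G (T n)))
    @ \oo --> (1 : R).

Definition O_star (R : realType) (T f : nat -> R) : Prop :=
  exists k : nat, (T : nat -> R^o) =O_\oo (fun n => n%:R ^+ k * f n : R^o).

(* Main.v *)
Require Import Defs.
From mathcomp Require Import all_boot all_order all_algebra.
From mathcomp Require Import all_classical all_reals all_analysis.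
From mathcomp Require Import zify ring lra.

Set Implicit Arguments.
Unset Strict Implicit.
Unset Printing Implicit Defensive.

Import Order.TTheory GRing.Theory Num.Theory.
Import numFieldNormedType.Exports.

(** In a random graph, almost surely, every two disjoint sets of k vertices are
    joined by an edge, for some k of order log n: the expected number of pairs
    that violate this is at most n^(2k) (1-p)^(k^2) (gnp_bihole_free).

    In a graph with this property every set V of vertices contains a set S of at
    most 3dk vertices such that each vertex has as many neighbours in S as in V,
    when numbers from d on are identified (small_seed).  With d = d(D), an entry
    of D does not distinguish such numbers (dmx_respects).  So the classes of a
    D-partition may be replaced by small sets S_1, ..., S_q, its seed.  Conversely,
    given sets S_i, the truncated numbers of neighbours that every vertex is to
    have in each class are known, and whether the S_i extend to a D-partition with
    the same truncated numbers can be decided for each vertex separately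
    (good_seed_sound and good_seed_complete).

    The algorithm tries all seeds of total size s = 3qdk, encoded by the numbers
    below ((q+1)n)^s, and tests each in polynomial time.  A positive answer is
    always right, and a negative one is right if the graph has the property
    above (program_correct).  Its running time is a fixed power of
    8(q+1)n ((q+1)n)^s, that is 2^O(log^2 n) when q and D are fixed, which is
    eventually below 2^(q d log^4 n) as soon as d > 0; when d = 0 there is only
    the empty seed, and the time is polynomial (O_star_bound).

    Programs are built from terms, small pieces of code that compute one number
    in a given context of registers; the rules for the judgement computes give
    their value and bound their cost at the same time. *)

(** * Terms and their cost *)

Section Terms.

Local Open Scope nat_scope.

(** Registers below the level r, together with the memory, form the context in
    which a subcomputation runs; agree says that it is left untouched. *)
Definition agree (r : nat) (s s' : store) : Prop :=
  (forall x, x < r -> reg s' x = reg s x) /\ heap s' = heap s.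

Lemma agree_refl r s : agree r s s.
Proof. by []. Qed.

Lemma agree_trans r s1 s2 s3 : agree r s1 s2 -> agree r s2 s3 -> agree r s1 s3.
Proof.
by case=> a1 b1 [a2 b2]; split=> [x xr|]; rewrite ?b2 ?b1 // a2 // a1.
Qed.

Lemma agree_le r r' s s' : r <= r' -> agree r' s s' -> agree r s s'.
Proof. by move=> le [a b]; split=> // x xr; apply: a; apply: leq_trans le. Qed.

Lemma agree_upd r x a s : r <= x -> agree r s (set_reg s x a).
Proof. by move=> le; split=> //= y yr; rewrite /upd; case: eqP => // yx; lia. Qed.

Lemma reg_upd s x a : reg (set_reg s x a) x = a.
Proof. by rewrite /= /upd eqxx. Qed.

Lemma reg_upd_neq s x a y : y != x -> reg (set_reg s x a) y = reg s y.
Proof. by rewrite /= /upd => /negbTE ->. Qed.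

(** A term is compiled at a level r: its code leaves the value in register r
    and uses only registers from r on as scratch. *)
Definition term := nat -> cmd.

(** The judgement is closed under raising the level and under any change of
    store that keeps the context, so a term can be placed inside loops without
    being proved again.  Costs are recorded only through the exponent h: when B
    is at least the number of turns of every loop, each construction adds a
    constant to h, so that h depends on the text of the program alone while B
    carries the dependence on the input. *)
Definition computes (B : nat) (s : store) (r : nat) (e : term) (v h : nat) :=
  forall r' s1, r <= r' -> agree r s s1 ->
  exists t s2, [/\ exec (e r') s1 t s2, t <= B ^ h, reg s2 r' = v & agree r' s1 s2].

Definition ccopy (r x : nat) : cmd := CSeq (CConst r 0) (CAdd r r x).
Definition tvar (x : nat) : term := fun r => ccopy r x.
Definition tconst (a : nat) : term := fun r => CConst r a.
Definition tadd (a b : term) : term := fun r =>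
  CSeq (a r) (CSeq (b r.+1) (CAdd r r r.+1)).
Definition tsub (a b : term) : term := fun r =>
  CSeq (a r) (CSeq (b r.+1) (CSub r r r.+1)).
Definition tread (a : term) : term := fun r => CSeq (a r) (CLoad r r).
Definition tif (c a b : term) : term := fun r =>
  CSeq (c r) (CIf r (a r) (b r)).

(** Register r holds the accumulator and r.+1 the index, which runs downwards;
    the body receives both as terms, so that bound variables need no names. *)
Definition tfold (e0 eN : term) (body : term -> term -> term) : term := fun r =>
  CSeq (e0 r) (CSeq (eN r.+1)
    (CWhile r.+1 (CSeq (CConst r.+2 1) (CSeq (CSub r.+1 r.+1 r.+2)
       (CSeq (body (tvar r) (tvar r.+1) r.+2) (ccopy r r.+2)))))).

Lemma exec_ccopy r x s : x != r ->
  exec (ccopy r x) s 2 (set_reg (set_reg s r 0) r (reg s x)).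
Proof.
move=> xr; apply: (@exec_seq _ _ s (set_reg s r 0) _ 1 1).
  exact: exec_const.
have := exec_add r r x (set_reg s r 0).
by rewrite reg_upd reg_upd_neq.
Qed.

Fixpoint foldn (g : nat -> nat -> nat) (n a : nat) : nat :=
  if n is k.+1 then foldn g k (g k a) else a.

Section Rules.
Variable B : nat.
Hypothesis B8 : 8 <= B.

Lemma B_gt0 : 0 < B. Proof. exact: leq_trans _ B8. Qed.

Lemma computes_weaken s r s' r' e v h :
  computes B s r e v h -> r <= r' -> agree r s s' -> computes B s' r' e v h.
Proof.
move=> ce le ag r1 s1 le1 ag1; apply: ce; first exact: leq_trans le1.
exact/(agree_trans ag)/(agree_le le).
Qed.

Lemma computes_mono s r e v h h' :
  computes B s r e v h -> h <= h' -> computes B s r e v h'.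
Proof.
move=> ce le r1 s1 le1 ag1; have [t [s2 [? tle ? ?]]] := ce _ _ le1 ag1.
by exists t, s2; split=> //; rewrite (leq_trans tle)// leq_pexp2l// B_gt0.
Qed.

(** The only inequality behind the cost rules: the costs of two consecutive
    parts and a small overhead are absorbed by one extra factor B. *)
Lemma expD2 a b c : c <= 6 -> B ^ a + B ^ b + c <= B ^ (a + b + 1).
Proof.
have := B_gt0 => B0 c6; rewrite !expnD expn1.
have : 0 < B ^ a by rewrite expn_gt0 B0.
have : 0 < B ^ b by rewrite expn_gt0 B0.
move: B8; move: (B ^ a) (B ^ b) => x y B8' x0 y0.
have h1 : x + y <= x * y + 1 by nia.
have : x * y * 8 <= x * y * B by rewrite leq_mul2l B8' orbT.
have : 1 <= x * y by nia.
lia.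
Qed.

Lemma computes_var s r x : x < r -> computes B s r (tvar x) (reg s x) 1.
Proof.
move=> xr r1 s1 le ag.
exists 2, (set_reg (set_reg s1 r1 0) r1 (reg s1 x)); split.
- by apply: exec_ccopy; lia.
- by rewrite expn1; apply: leq_trans _ B8.
- by rewrite reg_upd; case: ag => ->.
- by apply: (@agree_trans _ _ (set_reg s1 r1 0)); apply: agree_upd.
Qed.

Lemma computes_const s r a : computes B s r (tconst a) a 0.
Proof.
move=> r1 s1 le ag; exists 1, (set_reg s1 r1 a); split=> //.
- exact: exec_const.
- by rewrite reg_upd.
- exact: agree_upd.
Qed.

Lemma computes_bin (op : nat -> nat -> nat -> cmd) (f : nat -> nat -> nat) :
  (forall x y z s, exec (op x y z) s 1 (set_reg s x (f (reg s y) (reg s z)))) ->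
  forall s r a b va vb ha hb,
  computes B s r a va ha -> computes B s r b vb hb ->
  computes B s r (fun r => CSeq (a r) (CSeq (b r.+1) (op r r r.+1)))
    (f va vb) (ha + hb + 1).
Proof.
move=> opP s r a b va vb ha hb ca cb r1 s1 le ag.
have [t1 [s2 [e1 l1 v1 ag1]]] := ca _ _ le ag.
have [|| t2 [s3 [e2 l2 v2 ag2]]] := cb r1.+1 s2.
- by lia.
- exact: (agree_trans ag (agree_le le ag1)).
have v3 : reg s3 r1 = va by case: ag2 => -> //.
have := opP r1 r1 r1.+1 s3; rewrite v3 v2 => e3.
exists (t1 + (t2 + 1)), (set_reg s3 r1 (f va vb)); split.
- exact: exec_seq e1 (exec_seq e2 e3).
- by have := @expD2 ha hb 1 isT; lia.
- by rewrite reg_upd.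
- apply: (agree_trans ag1); apply: (@agree_trans _ _ s3); last exact: agree_upd.
  exact: agree_le ag2.
Qed.

Lemma computes_add s r a b va vb ha hb :
  computes B s r a va ha -> computes B s r b vb hb ->
  computes B s r (tadd a b) (va + vb) (ha + hb + 1).
Proof. exact: (computes_bin exec_add). Qed.

Lemma computes_sub s r a b va vb ha hb :
  computes B s r a va ha -> computes B s r b vb hb ->
  computes B s r (tsub a b) (va - vb) (ha + hb + 1).
Proof. exact: (computes_bin exec_sub). Qed.

Lemma computes_read s r a va ha :
  computes B s r a va ha -> computes B s r (tread a) (heap s va) (ha + 1).
Proof.
move=> ca r1 s1 le ag; have [t1 [s2 [e1 l1 v1 ag1]]] := ca _ _ le ag.
have := exec_load r1 r1 s2; rewrite v1 => e2.
have eqh : heap s2 = heap s by case: ag1 => _ ->; case: ag.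
exists (t1 + 1), (set_reg s2 r1 (heap s2 va)); split.
- exact: exec_seq e1 e2.
- by have := @expD2 ha 0 0 isT; rewrite !addn0 expn0; lia.
- by rewrite reg_upd eqh.
- by apply: (agree_trans ag1); apply: agree_upd.
Qed.

Lemma computes_if s r c a b vc va vb hc ha hb :
  computes B s r c vc hc ->
  (vc != 0 -> computes B s r a va ha) -> (vc = 0 -> computes B s r b vb hb) ->
  computes B s r (tif c a b) (if vc != 0 then va else vb) (hc + (ha + hb) + 1).
Proof.
move=> cc ca cb r1 s1 le ag; have [t1 [s2 [e1 l1 v1 ag1]]] := cc _ _ le ag.
have ag2 := agree_trans ag (agree_le le ag1).
have eh x y : B ^ x <= B ^ (x + y) /\ B ^ x <= B ^ (y + x).
  by split; rewrite leq_pexp2l ?B_gt0// ?leq_addr ?leq_addl.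
have [vc0|vc0] := eqVneq vc 0.
  have [t2 [s3 [e2 l2 v2 ag3]]] := cb vc0 _ _ le ag2.
  exists (t1 + t2.+1), s3; split=> //.
  - by apply: exec_seq e1 (exec_if_z _ _ e2); rewrite v1.
  - by have := @expD2 hc (ha + hb) 1 isT; have [_] := eh hb ha; lia.
  - exact: agree_trans ag1 ag3.
have [t2 [s3 [e2 l2 v2 ag3]]] := ca vc0 _ _ le ag2.
exists (t1 + t2.+1), s3; split=> //.
- by apply: exec_seq e1 (exec_if_nz _ _ e2); rewrite v1.
- by have := @expD2 hc (ha + hb) 1 isT; have [+ _] := eh ha hb; lia.
- exact: agree_trans ag1 ag3.
Qed.

(** Only the number of turns must be below B: the values that the accumulator
    takes are unrestricted, as addition has unit cost. *)
Lemma computes_fold s r e0 eN body g v0 n h0 hN hb :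
  computes B s r e0 v0 h0 -> computes B s r eN n hN -> n <= B ->
  (forall s' r' a k ta tk, r <= r' -> agree r s s' -> k < n ->
     computes B s' r' ta a 1 -> computes B s' r' tk k 1 ->
     computes B s' r' (body ta tk) (g k a) hb) ->
  computes B s r (tfold e0 eN body) (foldn g n v0) (h0 + hN + hb + 4).
Proof.
move=> c0 cN nB cb r1 s1 le ag.
have [t0 [s2 [E0 l0 v0' ag0]]] := c0 _ _ le ag.
have ag2 := agree_trans ag (agree_le le ag0).
have [||tN [s3 [EN lN vN agN]]] := cN r1.+1 s2; [lia|exact: ag2|].
have ag3 := agree_trans ag2 (agree_le (leqW le) agN).
pose W := CWhile r1.+1 (CSeq (CConst r1.+2 1) (CSeq (CSub r1.+1 r1.+1 r1.+2)
       (CSeq (body (tvar r1) (tvar r1.+1) r1.+2) (ccopy r1 r1.+2)))).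
have loop : forall m a st, m <= n -> reg st r1 = a -> reg st r1.+1 = m ->
    agree r1 s1 st -> exists t st', [/\ exec W st t st',
      t <= m * (B ^ hb + 5) + 1, reg st' r1 = foldn g m a & agree r1 s1 st'].
  elim=> [|m IH] a st mn ra rm agst.
    by exists 1, st; split=> //; exact: exec_while_z.
  pose sa := set_reg st r1.+2 1.
  pose sb := set_reg sa r1.+1 m.
  have Eb : exec (CSub r1.+1 r1.+1 r1.+2) sa 1 sb.
    have := exec_sub r1.+1 r1.+1 r1.+2 sa.
    rewrite reg_upd reg_upd_neq; last by lia.
    by rewrite rm subn1.
  have agb : agree r1 s1 sb.
    apply: (agree_trans agst); apply: (@agree_trans _ _ sa); apply: agree_upd; lia.
  have [|||tb [sc [Ec lc vc agc]]] := cb sb r1.+2 a m (tvar r1) (tvar r1.+1)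
      _ (agree_trans ag (agree_le le agb)) mn _ _ r1.+2 sb (leqnn _) (agree_refl _ _).
  - by lia.
  - have <- : reg sb r1 = a by rewrite /sb /sa !reg_upd_neq//; lia.
    exact: computes_var.
  - have <- : reg sb r1.+1 = m by rewrite /sb reg_upd.
    exact: computes_var.
  pose sd := set_reg (set_reg sc r1 0) r1 (g m a).
  have Ed : exec (ccopy r1 r1.+2) sc 2 sd.
    by rewrite /sd -vc; apply: exec_ccopy; lia.
  have [||||td [se [Ee le' ve age]]] := IH (g m a) sd.
  - by lia.
  - by rewrite /sd reg_upd.
  - rewrite /sd !reg_upd_neq; [|lia..].
    by case: agc => -> //; rewrite /sb reg_upd.
  - apply: (agree_trans agb); apply: (@agree_trans _ _ sc).
      by apply: agree_le agc; lia.
    by apply: (@agree_trans _ _ (set_reg sc r1 0)); apply: agree_upd.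
  exists ((1 + (1 + (tb + 2))) + td).+1, se; split=> //.
  - apply: exec_while_nz Ee; first by rewrite rm.
    apply: (@exec_seq _ _ _ sa); first exact: exec_const.
    by apply: (exec_seq Eb); apply: exec_seq Ec Ed.
  - by lia.
have [|||tW [s4 [EW lW vW agW]]] := loop n v0 s3 (leqnn _).
- by case: agN => -> //; rewrite v0'.
- by rewrite vN.
- by apply: (agree_trans ag0); apply: agree_le agN.
exists (t0 + (tN + tW)), s4; split=> //.
  exact: exec_seq E0 (exec_seq EN EW).
have {}lW : tW <= B ^ (hb + 2).
  apply: (leq_trans lW); apply: (@leq_trans (B * (B ^ hb + 5) + 1)).
    by rewrite leq_add2r leq_mul2r nB orbT.
  rewrite addn2 !expnS; have : 0 < B ^ hb by rewrite expn_gt0 B_gt0.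
  move: B8; move: (B ^ hb) => x B8' x0.
  have : B * 8 * x <= B * (B * x).
    by rewrite -mulnA leq_mul2l leq_mul2r B8' !orbT.
  nia.
have h1 := @expD2 h0 hN 0 isT; have h2 := @expD2 (h0 + hN + 1) (hb + 2) 0 isT.
have -> : h0 + hN + hb + 4 = h0 + hN + 1 + (hb + 2) + 1 by lia.
lia.
Qed.

End Rules.

End Terms.

Arguments computes_const {B s r} a.

(** * Derived terms *)

Section DerivedTerms.

Local Open Scope nat_scope.

Definition tle (a b : term) : term := tsub (tconst 1) (tsub a b).
Definition tand (a b : term) : term := tif a b (tconst 0).
Definition tor (a b : term) : term := tif a (tconst 1) b.
Definition tnot (a : term) : term := tsub (tconst 1) a.
Definition tpos (a : term) : term := tif a (tconst 1) (tconst 0).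
Definition teq (a b : term) : term := tand (tle a b) (tle b a).
Definition tsum (N : term) (F : term -> term) : term :=
  tfold (tconst 0) N (fun acc k => tadd acc (F k)).
Definition tex (N : term) (F : term -> term) : term := tpos (tsum N F).
Definition tall (N : term) (F : term -> term) : term :=
  tnot (tex N (fun k => tnot (F k))).
Definition tmul (a b : term) : term :=
  tfold (tconst 0) b (fun acc _ => tadd acc a).
Definition tpow (a b : term) : term :=
  tfold (tconst 1) b (fun acc _ => tmul acc a).

(** The quotient a / b is the number of k < a with (k + 1) b <= a. *)
Definition tdiv (a b : term) : term :=
  tsum a (fun k => tle (tmul (tadd k (tconst 1)) b) a).
Definition tmod (a b : term) : term := tsub a (tmul (tdiv a b) b).

(** Likewise, the number of k < a with 2 ^ k <= a is one more than the binary
    logarithm of a. *)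
Definition tlog (a : term) : term := tsum a (fun k => tle (tpow (tconst 2) k) a).

(** In tsumc, texc and tallc the index set is fixed with the program, and the
    loop is unrolled in its text. *)
Definition tsumc m (F : 'I_m -> term) : term :=
  foldr (fun i e => tadd (F i) e) (tconst 0) (enum 'I_m).
Definition texc m (F : 'I_m -> term) : term := tpos (tsumc F).
Definition tallc m (F : 'I_m -> term) : term :=
  tnot (texc (fun i => tnot (F i))).

(** A finite table for a function that is constant from d on; this is how the
    entries of D enter the program. *)
Fixpoint tlookup (g : nat -> nat) (d : nat) (e : term) : term :=
  if d is d'.+1 then
    tif e (tlookup (fun t => g t.+1) d' (tsub e (tconst 1))) (tconst (g 0))
  else tconst (g 0).

Section Derived.
Variable B : nat.
Hypothesis B8 : 8 <= B.
Local Notation computes := (computes B).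

Lemma computes_conv s r e v v' h h' :
  computes s r e v h -> v = v' -> h <= h' -> computes s r e v' h'.
Proof. by move=> ce <-; exact: computes_mono. Qed.

Lemma computes_le s r a b va vb ha hb :
  computes s r a va ha -> computes s r b vb hb ->
  computes s r (tle a b) (va <= vb) (ha + hb + 2).
Proof.
move=> ca cb.
apply: (computes_conv (computes_sub B8 (computes_const _)
          (computes_sub B8 ca cb))); last by lia.
by rewrite -subn_eq0; case: (va - vb).
Qed.

Lemma computes_and s r a b (va vb : bool) ha hb :
  computes s r a va ha -> (va -> computes s r b vb hb) ->
  computes s r (tand a b) (va && vb) (ha + hb + 1).
Proof.
move=> ca cb.
apply: (computes_conv (computes_if (va := vb) (vb := 0) (ha := hb) B8 ca _
  (fun _ => computes_const _))).
- by case: (va) cb => // /(_ isT).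
- by case: (va).
- by lia.
Qed.

Lemma computes_or s r a b (va vb : bool) ha hb :
  computes s r a va ha -> computes s r b vb hb ->
  computes s r (tor a b) (va || vb) (ha + hb + 1).
Proof.
move=> ca cb.
apply: (computes_conv (computes_if (va := 1) (vb := vb) (hb := hb) B8 ca
  (fun _ => computes_const _) (fun _ => cb))).
- by case: (va).
- by lia.
Qed.

Lemma computes_not s r a (va : bool) ha :
  computes s r a va ha -> computes s r (tnot a) (~~ va) (ha + 1).
Proof.
move=> ca.
apply: (computes_conv (computes_sub B8 (computes_const _) ca)).
- by case: (va).
- by lia.
Qed.

Lemma computes_pos s r a va ha :
  computes s r a va ha -> computes s r (tpos a) (va != 0) (ha + 1).
Proof.
move=> ca.
apply: (computes_conv (computes_if B8 ca
  (fun _ => computes_const 1) (fun _ => computes_const 0))).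
- by case: eqP.
- by lia.
Qed.

Lemma computes_eqn s r a b va vb ha hb :
  computes s r a va ha -> computes s r b vb hb ->
  computes s r (teq a b) (va == vb) (2 * ha + 2 * hb + 5).
Proof.
move=> ca cb; rewrite eqn_leq.
apply: (computes_conv (computes_and (computes_le ca cb)
  (fun _ => computes_le cb ca))) => //; lia.
Qed.

Lemma computes_sum s r N F n (f : 'I_n -> nat) hN hf :
  computes s r N n hN -> n <= B ->
  (forall s' r' tk (k : 'I_n), r <= r' -> agree r s s' ->
     computes s' r' tk k 1 -> computes s' r' (F tk) (f k) hf) ->
  computes s r (tsum N F) (\sum_(k < n) f k) (hN + hf + 6).
Proof.
move=> cN nB cF.
pose g k := if insub k is Some i then f i else 0.
have gE (k : 'I_n) : g k = f k by rewrite /g valK.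
have -> : \sum_(k < n) f k = foldn (fun k a => a + g k) n 0.
  rewrite -(eq_bigr _ (fun k _ => gE k)).
  have H m a : foldn (fun k a => a + g k) m a = a + \sum_(k < m) g k.
    elim: m a => [|m IH] a /=; first by rewrite big_ord0 addn0.
    by rewrite IH big_ord_recr /= addnAC addnA.
  by rewrite H add0n.
apply: (computes_conv (computes_fold (hb := hf + 2) B8 (computes_const _) cN nB _)) => //.
  move=> s' r' a k ta tk le ag kn ca ck.
  have := cF s' r' tk (Ordinal kn) le ag ck; rewrite -gE /= => cf.
  by apply: (computes_conv (computes_add B8 ca cf)) => //; lia.
lia.
Qed.

Lemma computes_ex s r N F n (f : 'I_n -> bool) hN hf :
  computes s r N n hN -> n <= B ->
  (forall s' r' tk (k : 'I_n), r <= r' -> agree r s s' ->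
     computes s' r' tk k 1 -> computes s' r' (F tk) (f k) hf) ->
  computes s r (tex N F) [exists k, f k] (hN + hf + 7).
Proof.
move=> cN nB cF.
apply: (computes_conv (computes_pos (computes_sum cN nB cF))); last by lia.
congr nat_of_bool; rewrite sum_nat_eq0 negb_forall.
by apply: eq_existsb => k; case: (f k).
Qed.

Lemma computes_all s r N F n (f : 'I_n -> bool) hN hf :
  computes s r N n hN -> n <= B ->
  (forall s' r' tk (k : 'I_n), r <= r' -> agree r s s' ->
     computes s' r' tk k 1 -> computes s' r' (F tk) (f k) hf) ->
  computes s r (tall N F) [forall k, f k] (hN + hf + 9).
Proof.
move=> cN nB cF.
apply: (computes_conv (computes_not (computes_ex (hf := hf + 1) (f
    := fun k => ~~ f k) cN nB _))).
- by move=> s' r' tk k le ag ck; apply: computes_not; apply: cF.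
- by congr nat_of_bool; rewrite negb_exists; apply: eq_forallb => k; rewrite negbK.
- by lia.
Qed.

Lemma computes_mul s r a b va vb ha hb :
  computes s r a va ha -> computes s r b vb hb -> vb <= B ->
  computes s r (tmul a b) (va * vb) (ha + hb + 6).
Proof.
move=> ca cb vB.
have -> : va * vb = foldn (fun _ x => x + va) vb 0.
  have H m x : foldn (fun _ x => x + va) m x = x + va * m.
    by elim: m x => [|m IH] x /=; rewrite ?IH; lia.
  by rewrite H.
apply: (computes_conv (computes_fold (hb := ha + 2) B8 (computes_const _) cb vB _)) => //.
  move=> s' r' x k tx tk le ag kn cx ck.
  by apply: (computes_conv (computes_add B8 cx (computes_weaken ca le ag))) => //; lia.
lia.
Qed.

Lemma computes_pow s r a b va vb ha hb :
  computes s r a va ha -> computes s r b vb hb -> va <= B -> vb <= B ->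
  computes s r (tpow a b) (va ^ vb) (ha + hb + 11).
Proof.
move=> ca cb aB vB.
have -> : va ^ vb = foldn (fun _ x => x * va) vb 1.
  have H m x : foldn (fun _ x => x * va) m x = x * va ^ m.
    by elim: m x => [|m IH] x /=; rewrite ?muln1// IH expnS mulnA.
  by rewrite H mul1n.
apply: (computes_conv (computes_fold (hb := ha + 7) B8 (computes_const _) cb vB _)) => //.
  move=> s' r' x k tx tk le ag kn cx ck.
  by apply: (computes_conv (computes_mul cx (computes_weaken ca le ag) _)) => //; lia.
lia.
Qed.

Lemma sum_initial m (P : nat -> bool) l : l <= m ->
  (forall k, P k = (k < l)) -> \sum_(k < m) P k = l.
Proof.
move=> lm PE.
have H j : \sum_(k < j) P k = minn l j.
  elim: j => [|j IH]; first by rewrite big_ord0 minn0.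
  by rewrite big_ord_recr /= IH PE; case: ltnP => /=; lia.
by rewrite H; apply/minn_idPl.
Qed.

Lemma computes_div s r a b va vb ha hb :
  computes s r a va ha -> computes s r b vb hb -> va <= B -> 0 < vb <= B ->
  computes s r (tdiv a b) (va %/ vb) (2 * ha + hb + 16).
Proof.
move=> ca cb aB /andP[b0 bB].
rewrite -(@sum_initial va (fun k => k.+1 * vb <= va) (va %/ vb)).
- apply: (computes_conv (computes_sum (hf := ha + hb + 10) (f
    := fun k : 'I_va => nat_of_bool (k.+1 * vb <= va)) ca aB _)) => //; last by lia.
  move=> s' r' tk k le ag ck; have wc v e h (c : computes s r e v h)
      := computes_weaken c le ag.
  apply: (computes_conv (computes_le (computes_mul (computes_add B8 ck
    (computes_const 1)) (wc _ _ _ cb) bB) (wc _ _ _ ca))); last by lia.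
  by rewrite addn1.
- exact: leq_div.
- by move=> k; rewrite leq_divRL.
Qed.

Lemma computes_mod s r a b va vb ha hb :
  computes s r a va ha -> computes s r b vb hb -> va <= B -> 0 < vb <= B ->
  computes s r (tmod a b) (va %% vb) (3 * ha + 2 * hb + 23).
Proof.
move=> ca cb aB /[dup] b0B /andP[b0 bB].
apply: (computes_conv (computes_sub B8 ca (computes_mul
    (computes_div ca cb aB b0B) cb bB))); last by lia.
by rewrite {1}(divn_eq va vb) addKn.
Qed.

Lemma computes_log s r a va ha :
  computes s r a va ha -> 0 < va <= B ->
  computes s r (tlog a) (trunc_log 2 va).+1 (2 * ha + 20).
Proof.
move=> ca /andP[a0 aB].
rewrite -(@sum_initial va (fun k => 2 ^ k <= va) (trunc_log 2 va).+1).
- apply: (computes_conv (computes_sum (hf := ha + 14) (f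
    := fun k : 'I_va => nat_of_bool (2 ^ k <= va)) ca aB _)) => //; last by lia.
  move=> s' r' tk k le ag ck; have wc v e h (c : computes s r e v h)
      := computes_weaken c le ag.
  apply: (computes_conv (computes_le (computes_pow
      (computes_const 2) ck _ _) (wc _ _ _ ca))) => //; first exact: leq_trans B8.
    by apply: leq_trans aB; apply: ltnW.
  lia.
- by apply: (leq_trans (ltn_expl (trunc_log 2 va) (isT : 1 < 2))); exact: trunc_logP.
- move=> k; rewrite ltnS; apply/idP/idP => [|kl]; first exact: trunc_log_max.
  by apply: leq_trans _ (trunc_logP (isT : 1 < 2) a0); rewrite leq_exp2l.
Qed.

Lemma computes_sumc s r m (F : 'I_m -> term) (f : 'I_m -> nat) hf :
  (forall i, computes s r (F i) (f i) hf) ->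
  computes s r (tsumc F) (\sum_i f i) (m * (hf + 1)).
Proof.
move=> cF; rewrite -[X in X * _]size_enum_ord /tsumc -big_enum /=.
elim: (enum 'I_m) => [|i l IH] /=; first by rewrite big_nil; exact: computes_const.
rewrite big_cons mulSn.
apply: (computes_conv (computes_add B8 (cF i) IH)) => //; lia.
Qed.

Lemma computes_exc s r m (F : 'I_m -> term) (f : 'I_m -> bool) hf :
  (forall i, computes s r (F i) (f i) hf) ->
  computes s r (texc F) [exists i, f i] (m * (hf + 1) + 1).
Proof.
move=> cF.
apply: (computes_conv (computes_pos (computes_sumc cF))); last by lia.
congr nat_of_bool; rewrite sum_nat_eq0 negb_forall.
by apply: eq_existsb => k; case: (f k).
Qed.

Lemma computes_allc s r m (F : 'I_m -> term) (f : 'I_m -> bool) hf :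
  (forall i, computes s r (F i) (f i) hf) ->
  computes s r (tallc F) [forall i, f i] (m * (hf + 2) + 2).
Proof.
move=> cF.
apply: (computes_conv (computes_not (computes_exc (hf := hf + 1) (f := fun k => ~~ f k) _))).
- by move=> i; apply: computes_not.
- by congr nat_of_bool; rewrite negb_exists; apply: eq_forallb => k; rewrite negbK.
- by lia.
Qed.

Lemma computes_lookup s r g d e v h :
  computes s r e v h ->
  computes s r (tlookup g d e) (g (minn d v)) (d * (h + d + 2)).
Proof.
elim: d g e v h => [|d IH] g e v h ce /=; first by rewrite min0n; exact: computes_const.
apply: (computes_conv (computes_if B8 ce
  (fun _ => IH (fun t => g t.+1) _ _ _ (computes_sub B8 ce (computes_const 1)))
  (fun _ => computes_const (g 0)))).
- case: eqP => [->|/eqP v0] //=; congr g.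
  by case: v v0 {ce} => // v _; rewrite subn1 minnSS.
- by nia.
Qed.

End Derived.

End DerivedTerms.

(** * Seeds of partitions *)

Section Seeds.

Local Open Scope nat_scope.
Local Open Scope set_scope.
Import mathcomp.boot.fintype mathcomp.boot.finset.

Lemma adj_sym n (G : sgraph n) u v : adj G u v = adj G v u.
Proof.
by have /andP[_ /forallP/(_ u)/forallP/(_ v)/eqP] := valP G.
Qed.

Lemma adj_irr n (G : sgraph n) u : adj G u u = false.
Proof. by have /andP[/forallP/(_ u)/negbTE] := valP G. Qed.

Definition cnt n (G : sgraph n) (v : 'I_n) (S : {set 'I_n}) : nat :=
  #|nbh G v :&: S|.

(** A seed prescribes a few vertices S i of every class V i of a partition to be
    found.  It is good when each vertex v can be put in some class i so that
    three things hold: the counts of the neighbours of v in the sets S j,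
    truncated at d, satisfy row i of D; the vertices of the seed stay in their
    class; and, unless v is already in S i, no truncated count changes, because
    every neighbour of v has d neighbours in S i already.  The choices for
    different vertices do not interact, hence the test takes polynomial time. *)
Definition good_seed q (D : 'M[set nat]_q) d n (G : sgraph n)
    (S : 'I_q -> {set 'I_n}) : bool :=
  [forall v, [exists i,
    [&& [forall j, `[< D i j (minn d (cnt G v (S j))) >]],
        [forall j, (j != i) ==> (v \notin S j)] &
        (v \in S i) || [forall u, adj G v u ==> (d <= cnt G u (S i))]]]].

Lemma cnt_subset n (G : sgraph n) v (S V : {set 'I_n}) :
  S \subset V -> cnt G v S <= cnt G v V.
Proof. by move=> SV; rewrite /cnt subset_leq_card// setIS. Qed.

(** Membership in mu does not distinguish numbers from d on. *)
Definition respects (d : nat) (mu : set nat) : Prop :=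
  forall c, mu c <-> mu (minn d c).

(** Adding vertices to S changes no count that is still below d. *)
Lemma minn_subset_eq n (G : sgraph n) d v (S V : {set 'I_n}) :
  S \subset V -> (forall u, u \in nbh G v -> u \in V -> u \notin S -> d <= cnt G v S) ->
  minn d (cnt G v S) = minn d (cnt G v V).
Proof.
move=> SV H.
have le : cnt G v S <= cnt G v V by exact: cnt_subset.
have [dS|Sd] := leqP d (cnt G v S).
  by apply/esym/minn_idPl/(leq_trans dS).
suff <- : cnt G v S = cnt G v V by apply/esym/minn_idPr/ltnW.
apply/eqP; rewrite eqn_leq le /= /cnt subset_leq_card//.
apply/subsetP => u /setIP[un uV]; rewrite inE un /=.
by apply/negPn/negP => uS; have := H u un uV uS; lia.
Qed.

(** Put each vertex in the class that the test found for it.  The truncated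
    counts remain those of the seed, and D sees only truncated counts. *)
Lemma good_seed_sound q (D : 'M[set nat]_q) d n (G : sgraph n) S :
  (forall i j, respects d (D i j)) -> good_seed D d G S -> has_Dpartition D G.
Proof.
move=> Dd /forallP good.
have /fin_all_exists [F FP] v := existsP (good v).
pose V i := [set v | F v == i].
have SV j : S j \subset V j.
  apply/subsetP => v vS; have /and3P[_ /forallP/(_ j)] := FP v.
  by rewrite vS implybF negbK inE eq_sym.
exists V; split.
- by apply/setP => v; rewrite !inE; apply/bigcupP; exists (F v); rewrite ?inE.
- move=> i j ij; rewrite -setI_eq0; apply/eqP/setP => v; rewrite !inE.
  by apply/negP => /andP[/eqP-> /eqP]; exact/eqP.
- move=> i j v; rewrite inE => /eqP Fv.
  have /and3P[/forallP/(_ j)/asboolP + _ _] := FP v; rewrite Fv.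
  rewrite (minn_subset_eq (SV j)) ?(Dd i j (cnt G v (V j)))// => u.
  rewrite !inE => vu /eqP Fu uS; have /and3P[_ _] := FP u.
  by rewrite Fu (negbTE uS) /= => /forallP/(_ v); rewrite adj_sym vu.
Qed.

(** If v lies in V i but not in S i, a neighbour u of v has strictly more
    neighbours in V i than in S i; as the truncated counts agree, both counts
    are at least d. *)
Lemma good_seed_complete q (D : 'M[set nat]_q) d n (G : sgraph n)
    (V S : 'I_q -> {set 'I_n}) :
  (forall i j, respects d (D i j)) -> is_Dpartition D G V ->
  (forall i, S i \subset V i) ->
  (forall i v, minn d (cnt G v (S i)) = minn d (cnt G v (V i))) ->
  good_seed D d G S.
Proof.
move=> Dd [cov dis DV] SV eqS.
have uniqV v i j : v \in V i -> v \in V j -> i = j.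
  move=> vi vj; apply/eqP/negPn/negP => /dis.
  by rewrite -setI_eq0 => /eqP/setP/(_ v); rewrite !inE vi vj.
apply/forallP => v; have /bigcupP[i _ vi] : v \in \bigcup_i V i by rewrite cov inE.
apply/existsP; exists i; apply/and3P; split.
- by apply/forallP => j; apply/asboolP; rewrite eqS; apply: (Dd i j _).1; exact: DV.
- apply/forallP => j; apply/implyP => ji; apply/negP => /(subsetP (SV j)) vj.
  by rewrite (uniqV _ _ _ vi vj) eqxx in ji.
- have [//|/= vS] := boolP (v \in S i).
  apply/forallP => u; apply/implyP => vu.
  have lt : cnt G u (S i) < cnt G u (V i).
    apply: proper_card; apply/properP; split; first exact: setIS.
    by exists v; rewrite !inE adj_sym vu ?vi// (negbTE vS).
  by have := eqS i u; lia.
Qed.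

(** The quasi-random property that replaces the random graph in the
    combinatorial part. *)
Definition bihole_free k n (G : sgraph n) : Prop :=
  forall X Y : {set 'I_n}, #|X| = k -> #|Y| = k -> [disjoint X & Y] ->
    exists x y, [/\ x \in X, y \in Y & adj G x y].

Lemma subset_of_card (T : finType) (A : {set T}) k : k <= #|A| ->
  exists2 X : {set T}, X \subset A & #|X| = k.
Proof.
move=> kA; exists [set x in take k (enum A)].
  by apply/subsetP => x; rewrite inE => /mem_take; rewrite mem_enum.
rewrite cardsE; have /card_uniqP -> := take_uniq k (enum_uniq A).
by rewrite size_takel // -cardE.
Qed.

(** Any k vertices X of V dominate all but fewer than k vertices outside X.
    One neighbour in V is added for each vertex, in X or outside, that X fails
    to dominate. *)
Lemma small_dominating k n (G : sgraph n) (V : {set 'I_n}) : bihole_free k G ->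
  exists S : {set 'I_n}, [/\ S \subset V, #|S| <= 3 * k &
    forall v, 0 < cnt G v V -> 0 < cnt G v S].
Proof.
move=> free; have [Vk|/ltnW kV] := leqP #|V| k; first by exists V; split=> //; lia.
have [X XV Xk] := subset_of_card kV.
pose U := [set v | (cnt G v X == 0) && (0 < cnt G v V)].
have wP v : exists w, (v \in U) ==> (w \in nbh G v :&: V).
  have [|_] := boolP (v \in U); last by exists v.
  by rewrite inE => /andP[_]; rewrite card_gt0 => /set0Pn[w wV]; exists w.
have /fin_all_exists [w {}wP] := wP.
have UXk : #|U :\: X| < k.
  rewrite ltnNge; apply/negP => /subset_of_card [Y YU Yk].
  have [|x [y [xX yY xy]]] := free X Y Xk Yk.
    rewrite -setI_eq0; apply/eqP/setP => z; rewrite !inE; apply/negP => /andP[zX zY].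
    by have := subsetP YU _ zY; rewrite inE zX.
  have := subsetP YU _ yY; rewrite !inE => /and3P[_ + _].
  by rewrite cards_eq0 => /eqP/setP/(_ x); rewrite !inE adj_sym xy xX.
exists (X :|: w @: U); split.
- rewrite subUset XV; apply/subsetP => _ /imsetP[v vU ->].
  by have := wP v; rewrite vU => /setIP[].
- have h1 := (leq_card_setU X (w @: U)).1.
  have h2 := leq_imset_card w U.
  have h3 := cardsID X U.
  have h4 : #|U :&: X| <= #|X| by apply/subset_leq_card/subsetIr.
  apply: (leq_trans h1); apply: (@leq_trans (k + #|U|)).
    by rewrite Xk leq_add2l.
  apply: (@leq_trans (k + (k + k))); last by lia.
  by rewrite leq_add2l -h3 leq_add ?(ltnW UXk)// -Xk.
- move=> v vV; have [v0|v0] := eqVneq (cnt G v X) 0.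
    have vU : v \in U by rewrite inE v0 eqxx.
    rewrite card_gt0; apply/set0Pn; exists (w v).
    have := wP v; rewrite vU /= => /setIP[h _].
    by rewrite inE h inE imset_f ?orbT.
  apply: (@leq_trans (cnt G v X)); first by rewrite lt0n.
  exact/cnt_subset/subsetUl.
Qed.

(** Induction on d.  A dominating set S1 of V settles the first neighbour of
    every vertex; the induction hypothesis in V minus S1 settles the others. *)
Lemma small_seed k n (G : sgraph n) d (V : {set 'I_n}) : bihole_free k G ->
  exists S : {set 'I_n}, [/\ S \subset V, #|S| <= d * (3 * k) &
    forall v, minn d (cnt G v S) = minn d (cnt G v V)].
Proof.
move=> free; elim: d V => [|d IH] V.
  by exists set0; split=> [||v]; rewrite ?sub0set ?cards0// !min0n.
have [S1 [S1V S1k dom]] := small_dominating V free.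
have [S2 [S2V S2k eq2]] := IH (V :\: S1).
have cntU (A B : {set 'I_n}) v : [disjoint A & B] -> cnt G v (A :|: B) = cnt G v A + cnt G v B.
  move=> AB; rewrite /cnt setIUr cardsU [X in _ - X](_ : _ = 0) ?subn0//.
  by apply/eqP; rewrite cards_eq0 setIACA setIid (disjoint_setI0 AB) setI0.
have dis : [disjoint S1 & V :\: S1] by rewrite disjoint_sym -setI_eq0 setIDAC setDIl setDv setI0.
exists (S1 :|: S2); split.
- by rewrite subUset S1V (subset_trans S2V) ?subsetDl.
- apply: (leq_trans (leq_card_setU S1 S2).1).
  by move: S1k S2k; move: #|S1| #|S2| => a b; lia.
- move=> v.
  have eV : cnt G v V = cnt G v S1 + cnt G v (V :\: S1).
    by rewrite -cntU // setDE setUIr setUCr setIT (setUidPr S1V).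
  rewrite cntU; last exact: disjointWr S2V dis.
  have := dom v; have := eq2 v; have := cnt_subset G v S2V; rewrite eV.
  move: (cnt G v S1) (cnt G v S2) (cnt G v (V :\: S1)) => a b c bc eqbc.
  have [->|a0] := posnP a; last by move=> _; lia.
  by case: c bc eqbc => [|c] bc eqbc; [lia|move=> /(_ isT)].
Qed.

End Seeds.

(** * Truncation of finite and co-finite sets *)

Section Truncation.

Local Open Scope nat_scope.
Local Open Scope classical_set_scope.

Lemma setmax_finite (A : set nat) : finite_set A -> A !=set0 ->
  exists m, [/\ A m, forall x, A x -> x <= m & setmax A = (Posz m)%:E].
Proof.
move=> finA A0; rewrite /setmax.
case: asboolP => [A00|_]; first by move: A0; rewrite A00 => -[].
case: asboolP => // _.
case: xgetP => [m _ [Am mP]|noA]; first by exists m; split.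
have [N NP] : exists N, forall x, A x -> x <= N.
  have /finite_seqP[X ->] := finA.
  by exists (\max_(x <- X) x) => x /= xX; apply: leq_bigmax_seq.
have exA : exists x, `[< A x >] by case: A0 => x Ax; exists x; apply/asboolP.
have ubA x : `[< A x >] -> x <= N by move=> /asboolP; exact: NP.
case: (ex_maxnP exA ubA) => m /asboolP Am mP.
by case: (noA m); split=> // x Ax; apply: mP; apply/asboolP.
Qed.

Lemma setmax_infinite (A : set nat) : infinite_set A -> setmax A = +oo%E.
Proof.
move=> infA; rewrite /setmax; case: asboolP => [A0|_].
  by case: infA; rewrite A0.
by case: asboolP.
Qed.

Lemma finite_setC_nat (A : set nat) : finite_set A -> infinite_set (~` A).
Proof.
move=> finA finC; apply: infinite_nat; rewrite -(setUv A).
by rewrite finite_setU.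
Qed.

Lemma absz_fine_succ m : absz (fine (1%:E + (Posz m)%:E)%E) = m.+1.
Proof. by []. Qed.

(** Unless mu is empty or full, one of mu and its complement has a maximum m, and
    the other is infinite; then dset mu = m.+1 and all numbers above m lie on the same side
    of mu. *)
Lemma dset_respects mu d : fin_or_cofin mu -> dset mu <= d -> respects d mu.
Proof.
rewrite /dset; case: asboolP => [->//|muT] finmu dd c.
have [//|dc] := leqP c d.
case: finmu => [fin|cofin].
  have [mu0|mu0] := pselect (mu = set0); first by rewrite mu0.
  have {}mu0 : mu !=set0 by apply/set0P/eqP.
  have [m [_ mP mE]] := setmax_finite fin mu0.
  move: dd; rewrite mE (setmax_infinite (finite_setC_nat fin)).
  rewrite min_l ?leey// absz_fine_succ => dd.
  by split=> /mP; lia.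
have C0 : ~` mu !=set0.
  by apply/set0P/eqP => /(congr1 setC); rewrite setCK setC0.
have [m [_ mP mE]] := setmax_finite cofin C0.
have inf : infinite_set mu by rewrite -[mu]setCK; apply: finite_setC_nat.
move: dd; rewrite mE (setmax_infinite inf) min_r ?leey// absz_fine_succ => dd.
by split=> _; apply: contrapT => /mP; lia.
Qed.

Lemma dmx_respects q (D : 'M[set nat]_q) :
  (forall i j, fin_or_cofin (D i j)) -> forall i j, respects (dmx D) (D i j).
Proof.
move=> finD i j; apply: dset_respects => //.
rewrite /dmx; apply: leq_trans (leq_bigmax i).
exact: (leq_bigmax (F := fun j => dset (D i j)) j).
Qed.

End Truncation.

(** * The random graph *)

Section RandomGraph.

Local Open Scope ring_scope.
Import mathcomp.boot.fintype mathcomp.boot.finset.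

Section Sym.
Variable n : nat.
Implicit Types (f : {ffun 'I_n * 'I_n -> bool}).

(** Graphs correspond to boolean functions supported on the pairs u < v, through
    symmetrize and upper. *)
Definition symmetrize f : {ffun 'I_n * 'I_n -> bool} :=
  [ffun e : 'I_n * 'I_n => if (e.1 < e.2)%N then f e else (e.2 < e.1)%N && f (e.2, e.1)].

Lemma symmetrizeP f : sgraph_axiom (symmetrize f).
Proof.
apply/andP; split; first by apply/forallP => u; rewrite ffunE /= ltnn.
apply/forallP => u; apply/forallP => v; rewrite !ffunE /=.
by case: ltngtP => // ->.
Qed.

Definition upper (G : sgraph n) : {ffun 'I_n * 'I_n -> bool} :=
  [ffun e : 'I_n * 'I_n => (e.1 < e.2)%N && adj G e.1 e.2].

Lemma upperK (G : sgraph n) : SGraph (symmetrizeP (upper G)) = G.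
Proof.
apply: val_inj; apply/ffunP => -[u v]; rewrite !ffunE /=.
rewrite -/(adj G u v); case: ltngtP => //= [_|/val_inj->]; first by rewrite adj_sym.
by rewrite adj_irr.
Qed.

Lemma adj_symmetrize f (e : 'I_n * 'I_n) : (e.1 < e.2)%N ->
  adj (SGraph (symmetrizeP f)) e.1 e.2 = f e.
Proof. by case: e => u v /= uv; rewrite /adj ffunE /= uv. Qed.

(** Independence of the edges: expanding the product on the right gives one
    term for each boolean function on the pairs u < v, that is for each graph. *)
Lemma sum_sgraph_prod (R : comPzRingType) (F : 'I_n * 'I_n -> bool -> R) :
  \sum_(G : sgraph n) \prod_(e : 'I_n * 'I_n | (e.1 < e.2)%N) F e (adj G e.1 e.2)
  = \prod_(e : 'I_n * 'I_n | (e.1 < e.2)%N) (F e true + F e false).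
Proof.
under [RHS]eq_bigr do rewrite -big_bool.
rewrite (big_distr_big_dep false) (reindex_onto (fun f => SGraph (symmetrizeP f)) upper) /=;
  last by move=> G _; exact: upperK.
apply: eq_big => [f|f _]; last first.
  by apply: eq_bigr => e lte; rewrite adj_symmetrize.
apply/eqP/pfamilyP => [<-|[supp _]].
  split; first by apply/supportP => e /negbTE lte; rewrite ffunE; move: lte;
      rewrite unfold_in => ->.
  by move=> e _.
apply/ffunP => e; rewrite ffunE; have [lte|lte] := boolP (e.1 < e.2)%N.
  by rewrite adj_symmetrize.
by apply/esym/(supportP supp).
Qed.

End Sym.

Section Gnp.
Variables (R : realType) (p : R).
Hypotheses (p_gt0 : 0 < p) (p_lt1 : p < 1).

Lemma gnp_ge0 n (G : sgraph n) : 0 <= gnp p G.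
Proof. by apply: prodr_ge0 => e _; case: ifP => _; rewrite ?subr_ge0 ltW. Qed.

Lemma gnp_total n : \sum_(G : sgraph n) gnp p G = 1.
Proof.
rewrite (sum_sgraph_prod (fun _ b => if b then p else 1 - p)) big1// => e _.
by rewrite addrC subrK.
Qed.

Lemma gnp_prob_sub n (E F : sgraph n -> Prop) :
  (forall G, E G -> F G) -> gnp_prob p E <= gnp_prob p F.
Proof.
move=> EF; rewrite /gnp_prob [leRHS](bigID (fun G => `[< E G >])) /=.
rewrite -[leLHS]addr0 lerD ?sumr_ge0// => [|G _]; last exact: gnp_ge0.
rewrite le_eqVlt; apply/orP; left; apply/eqP; apply: eq_bigl => G.
by apply/idP/andP => [/asboolP EG|[]//]; split; apply/asboolP => //; exact: EF.
Qed.

Lemma gnp_prob_le1 n (E : sgraph n -> Prop) : gnp_prob p E <= 1.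
Proof.
rewrite -(gnp_total n) [leRHS](bigID (fun G => `[< E G >])) /=.
by rewrite lerDl sumr_ge0// => G _; exact: gnp_ge0.
Qed.

(** The indicator of the event is itself a product over pairs: give weight 0 to
    the presence of an edge of E0. *)
Lemma gnp_no_edges n (E0 : {set 'I_n * 'I_n}) :
  (forall e, e \in E0 -> (e.1 < e.2)%N) ->
  \sum_(G : sgraph n | [forall e, (e \in E0) ==> ~~ adj G e.1 e.2]) gnp p G
  = (1 - p) ^+ #|E0|.
Proof.
move=> ltE; rewrite big_mkcond /=.
pose F (e : 'I_n * 'I_n) (b : bool) : R :=
  if b then if e \in E0 then 0 else p else 1 - p.
transitivity (\sum_(G : sgraph n) \prod_(e : 'I_n * 'I_n | (e.1 < e.2)%N) F e (adj G e.1 e.2)).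
  apply: eq_bigr => G _; case: ifPn => [/forallP no|].
    apply: eq_bigr => e _; rewrite /F; case: ifP => // adje.
    by have := no e; rewrite adje implybF => /negbTE ->.
  rewrite negb_forall => /existsP[e]; rewrite negb_imply negbK => /andP[eE ae].
  by rewrite (bigD1 e) ?ltE//= /F ae eE mul0r.
rewrite sum_sgraph_prod (bigID (mem E0)) /= [X in _ * X]big1 ?mulr1 => [|e].
  rewrite -prodr_const; apply: eq_big => e.
    by apply/andP/idP => [[]//|eE]; rewrite ltE.
  by move=> /andP[_ eE]; rewrite /F eE add0r.
by move=> /andP[_ /negbTE eE]; rewrite /F eE addrC subrK.
Qed.

Definition no_edge n (G : sgraph n) (X Y : {set 'I_n}) : bool :=
  [forall x in X, [forall y in Y, ~~ adj G x y]].

(** As X and Y are disjoint, the pairs of the product of X and Y are distinct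
    unordered pairs of vertices. *)
Lemma gnp_no_edge n (X Y : {set 'I_n}) : [disjoint X & Y] ->
  \sum_(G : sgraph n | no_edge G X Y) gnp p G <= (1 - p) ^+ (#|X| * #|Y|).
Proof.
move=> dis.
have XY z : z \in X -> z \in Y -> False.
  by move=> zX zY; have /setP/(_ z) := disjoint_setI0 dis; rewrite !inE zX zY.
pose ord (e : 'I_n * 'I_n) := if (e.1 < e.2)%N then e else (e.2, e.1).
pose E0 := ord @: setX X Y.
have cardE : #|E0| = (#|X| * #|Y|)%N.
  rewrite card_in_imset ?cardsX// => -[x y] [x' y']; rewrite !inE /= /ord /=.
  move=> /andP[xX yY] /andP[x'X y'Y]; do 2 case: ifP => _; move=> [] //.
  - by move=> -> ->.
  - by move=> xy' _; case: (XY x xX); rewrite xy'.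
  - by move=> _ xy'; case: (XY x xX); rewrite xy'.
  - by move=> -> ->.
rewrite -cardE -gnp_no_edges.
  rewrite big_mkcond [leRHS]big_mkcond; apply: ler_sum => G _ /=.
  case: ifPn => [/forallP no|_]; last by case: ifP => _ //; exact: gnp_ge0.
  rewrite ifT//; apply/forallP => e; apply/implyP => /imsetP[[x y]];
      rewrite inE /= => /andP[xX yY] ->.
  have := no x; rewrite xX => /forallP/(_ y); rewrite yY /= /ord /=; case: ifP => //= _.
  by rewrite adj_sym.
move=> e /imsetP[[x y]]; rewrite inE /= => /andP[xX yY] ->; rewrite /ord /=.
have [//|//|xy] := ltngtP (x : nat) (y : nat); case: (XY y _ yY).
by rewrite -(val_inj xy).
Qed.

Lemma bin_le_exp m k : ('C(m, k) <= m ^ k)%N.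
Proof.
elim: m k => [|m IH] [|k] //; rewrite ?bin0// binS.
apply: (@leq_trans (m ^ k.+1 + m ^ k)); first exact: leq_add.
by rewrite !expnSr -mulnSr leq_mul2r; case: k => [//|k]; rewrite leq_exp2r// leqnSn orbT.
Qed.

(** Union bound over the pairs of disjoint k-sets. *)
Lemma gnp_bihole_free k n :
  1 - (n ^ (k + k))%:R * (1 - p) ^+ (k * k) <= gnp_prob p (bihole_free k (n := n)).
Proof.
have -> : gnp_prob p (bihole_free k (n := n)) =
    1 - \sum_(G : sgraph n | ~~ `[< bihole_free k G >]) gnp p G.
  by rewrite -(gnp_total n) (bigID (fun G => `[< bihole_free k G >])) /= addrK.
rewrite lerD2l lerN2.
pose W := [set XY : {set 'I_n} * {set 'I_n} | [&& #|XY.1| == k, #|XY.2| == k & [disjoint XY.1 & XY.2]]].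
apply: (@le_trans _ _ (\sum_(XY in W) \sum_(G : sgraph n | no_edge G XY.1 XY.2) gnp p G)).
  rewrite big_mkcond.
  under [leRHS]eq_bigr do rewrite big_mkcond.
  rewrite exchange_big /=; apply: ler_sum => G _.
  case: ifPn => [/asboolP nfree|_]; last first.
    by apply: sumr_ge0 => XY _; case: ifP => // _; exact: gnp_ge0.
  have [XY XYW noXY] : exists2 XY, XY \in W & no_edge G XY.1 XY.2.
    apply: contrapT => noW; apply: nfree => X Y Xk Yk dis.
    have /negP : ~ no_edge G X Y.
      by move=> noXY; apply: noW; exists (X, Y); rewrite // inE /= Xk Yk !eqxx.
    rewrite negb_forall => /existsP[x]; rewrite negb_imply => /andP[xX].
    rewrite negb_forall => /existsP[y]; rewrite negb_imply negbK => /andP[yY xy].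
    by exists x, y.
  rewrite (bigD1 XY)//= noXY lerDl sumr_ge0// => ? _.
  by case: ifP => // _; exact: gnp_ge0.
apply: (@le_trans _ _ (\sum_(XY in W) (1 - p) ^+ (k * k))).
  apply: ler_sum => XY; rewrite inE => /and3P[/eqP Xk /eqP Yk dis].
  by rewrite -{1}Xk -Yk; exact: gnp_no_edge.
rewrite sumr_const -[leLHS]mulr_natl ler_wpM2r ?exprn_ge0 ?subr_ge0 ?(ltW p_lt1)// ler_nat.
pose K := [set X : {set 'I_n} | #|X| == k].
apply: (@leq_trans #|setX K K|).
  by apply/subset_leq_card/subsetP => XY; rewrite !inE => /and3P[-> ->].
have cardK : (#|K| <= n ^ k)%N by rewrite card_draws card_ord bin_le_exp.
by rewrite cardsX expnD leq_mul.
Qed.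

End Gnp.

End RandomGraph.

(** * The program *)

Section Program.

Local Open Scope nat_scope.
Import mathcomp.boot.fintype mathcomp.boot.finset.

Definition digit (M x l : nat) : nat := x %/ M ^ l %% M.

Lemma exists_digits M s j ds : j < M -> (forall t, t \in ds -> t < M) ->
  exists2 x, x < M ^ s & forall l, l < s -> digit M x l = nth j ds l.
Proof.
move=> jM; elim: s ds => [|s IH] ds dsM; first by exists 0.
have [x xM xP] : exists2 x, x < M ^ s & forall l, l < s -> digit M x l = nth j (behead ds) l.
  by apply: IH => t /mem_behead; exact: dsM.
have M0 : 0 < M by exact: leq_ltn_trans jM.
have hM : head j ds < M by case: ds dsM {xP} => //= t ds; apply; rewrite inE eqxx.
exists (x * M + head j ds).
  by rewrite expnSr; apply: (@leq_trans (x.+1 * M));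
      [rewrite mulSn; lia|rewrite leq_mul2r xM orbT].
move=> [_|l ls]; first by rewrite /digit expn0 divn1 modnMDl modn_small// nth0.
rewrite /digit expnS divnMA divnMDl// (divn_small hM) addn0.
by rewrite -/(digit M x l) xP// nth_behead.
Qed.

(** The number x lists a seed in base (q + 1) n: the digit i n + v with i < q puts
    the vertex v in S i, and the remaining digits, q n and above, stand for
    nothing. *)
Definition seed q n s x (i : 'I_q) : {set 'I_n} :=
  [set v : 'I_n | [exists l : 'I_s, digit (q.+1 * n) x l == i * n + v]].

Lemma code_inj n i i' (v v' : 'I_n) : i * n + v = i' * n + v' -> i = i' /\ v = v'.
Proof.
move=> e; have n0 : 0 < n by case: n v {v' e} => // -[].
have ii : i = i'.
  by have := congr1 (fun m => m %/ n) e; rewrite !divnMDl// !divn_small// !addn0.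
by split=> //; apply: val_inj => /=; move: e; rewrite ii => /addnI.
Qed.

(** List the codes of the pairs (i, v) with v in S i, and pad with the neutral
    digit q n. *)
Lemma exists_seed q n s (S : 'I_q -> {set 'I_n}) : 0 < n -> \sum_i #|S i| <= s ->
  exists2 x, x < (q.+1 * n) ^ s & seed n s x = S.
Proof.
move=> n0 Ss.
pose A := [set iv : 'I_q * 'I_n | iv.2 \in S iv.1].
pose code (iv : 'I_q * 'I_n) : nat := iv.1 * n + iv.2.
pose ds := [seq code iv | iv <- enum A].
have code_lt (i : 'I_q) (v : 'I_n) : i * n + v < q * n.
  by apply: (@leq_trans (i.+1 * n)); [rewrite mulSn; have
      := ltn_ord v; lia|rewrite leq_mul2r ltn_ord orbT].
have dsM t : t \in ds -> t < q.+1 * n.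
  move=> /mapP[iv _ ->]; apply: (leq_trans (code_lt _ _)).
  by rewrite leq_mul2r leqnSn orbT.
have sz : size ds <= s.
  rewrite size_map -cardE (leq_trans _ Ss)// -sum1_card.
  rewrite (eq_bigl (fun iv : 'I_q * 'I_n => true && (iv.2 \in S iv.1)));
      last by move=> iv; rewrite inE.
  by rewrite -(pair_big_dep xpredT (fun i v => v \in S i)
      (fun _ _ => 1)) /= leq_sum// => i _; rewrite sum1_card.
have jM : q * n < q.+1 * n by rewrite ltn_mul2r n0 ltnSn.
have [x xM xP] := exists_digits s jM dsM.
exists x => //; apply/funext => i; apply/setP => v; rewrite inE.
apply/existsP/idP => [[l]|vS].
  rewrite xP//; have [ls|sl] := ltnP l (size ds).
    have /mapP[[i' v']] := mem_nth (q * n) ls.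
    rewrite mem_enum inE /= => vS -> /eqP /code_inj[/val_inj ii vv].
    by rewrite -ii -vv.
  by rewrite nth_default// => /eqP e; have := code_lt i v; rewrite -e ltnn.
have ivds : i * n + v \in ds by apply: (map_f code (x := (i, v))); rewrite mem_enum inE.
have ls : index (i * n + v) ds < s by apply: leq_trans sz; rewrite index_mem.
by exists (Ordinal ls); rewrite xP//= nth_index.
Qed.

Section Algorithm.
Variables (q d c0 : nat) (D : 'M[set nat]_q).

Definition torder : term := tvar 0.
Definition tbase : term := tmul (tconst q.+1) torder.
Definition tdigits : term := tmul (tconst c0) (tlog torder).
Definition tdigit (x l : term) : term := tmod (tdiv x (tpow tbase l)) tbase.
Definition tseed (x : term) (i : nat) (v : term) : term :=
  tex tdigits (fun l => teq (tdigit x l) (tadd (tmul (tconst i) torder) v)).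
Definition tadj (u v : term) : term := tread (tadd (tmul u torder) v).
Definition tcnt (x : term) (i : nat) (u : term) : term :=
  tsum torder (fun w => tand (tadj u w) (tseed x i w)).
Definition tcheck (x : term) : term :=
  tall torder (fun v => texc (fun i : 'I_q =>
    tand (tallc (fun j : 'I_q => tlookup (fun t => `[< D i j t >] : nat) d (tcnt x j v)))
   (tand (tallc (fun j : 'I_q => if j != i then tnot (tseed x j v) else tconst 1))
         (tor (tseed x i v)
            (tall torder (fun u => tor (tnot (tadj v u)) (tle (tconst d) (tcnt x i u)))))))).
Definition tanswer : term := tex (tpow tbase tdigits) tcheck.

Definition program : cmd := CSeq (tanswer 1) (ccopy 0 1).

(** These exponents add up, with some rounding, what the cost rules yield for the
    text of the program; all that matters is that they do not depend on n. *)
Definition hcheck : nat :=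
  1 + (q * ((q * (d * (422 + d) + 2) + 2)
            + ((q * 403 + 2) + (400 + 446 + 1) + 1) + 1 + 1) + 1) + 9.
Definition hprogram : nat := 46 + hcheck + 8.

Section Run.
Variables (n : nat) (G : sgraph n).
Hypothesis n_gt0 : 0 < n.
Let M := q.+1 * n.
Let s := c0 * (trunc_log 2 n).+1.

(** Every loop of the program makes at most this number of turns: the longest
    one runs through the M ^ s codes of seeds; the factor 8 is what the cost
    rules require, and M keeps n itself below the bound. *)
Definition bound : nat := 8 * M * M ^ s.
Let B := bound.
Local Notation computes := (computes B).

Lemma base_gt0 : 0 < M. Proof. by rewrite muln_gt0. Qed.
Lemma codes_gt0 : 0 < M ^ s. Proof. by rewrite expn_gt0 base_gt0. Qed.
Lemma bound_ge8 : 8 <= B.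
Proof. by rewrite /B /bound -mulnA leq_pmulr// muln_gt0 base_gt0 codes_gt0. Qed.
Lemma base_le_bound : M <= B.
Proof. by rewrite /B /bound mulnAC leq_pmull// muln_gt0 codes_gt0. Qed.
Lemma order_le_bound : n <= B.
Proof. by apply: leq_trans base_le_bound; rewrite leq_pmull. Qed.
Lemma codes_le_bound : M ^ s <= B.
Proof. by rewrite /B /bound leq_pmull// muln_gt0 base_gt0. Qed.
Lemma pow_le_bound l : l <= s -> M ^ l <= B.
Proof. by move=> ls; apply: leq_trans codes_le_bound; rewrite leq_pexp2l// base_gt0. Qed.
Lemma trunc_log_lt : (trunc_log 2 n).+1 <= n.
Proof.
apply: leq_trans (ltn_expl (trunc_log 2 n) (isT : 1 < 2)) _.
exact: trunc_logP.
Qed.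
Lemma digits_le_bound : 1 <= q -> s <= B.
Proof.
move=> q1; have [n1|n1] := eqVneq (M) 1; first by rewrite /M in n1; move: n1 n_gt0 q1; nia.
apply: leq_trans codes_le_bound; apply/ltnW/ltn_expl; have := base_gt0; lia.
Qed.

Definition framed (st : store) (r : nat) : Prop :=
  [/\ 0 < r, reg st 0 = n & heap st = heap (input G)].

Lemma framed_ext st r st' r' : framed st r -> r <= r' -> agree r st st' -> framed st' r'.
Proof.
move=> [r0 n0 h0] le [ag hh]; split; first exact: leq_trans le.
  by rewrite ag.
by rewrite hh.
Qed.

Lemma computes_order st r : framed st r -> computes st r torder n 1.
Proof.
case=> r0 rn _; apply: (computes_conv bound_ge8 (computes_var bound_ge8 r0)) => //.
Qed.

Lemma computes_base st r : framed st r -> computes st r tbase M 7.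
Proof.
move=> fr; apply: (computes_conv bound_ge8
    (computes_mul bound_ge8 (computes_const q.+1) (computes_order fr) order_le_bound)) => //.
Qed.

Lemma computes_digits st r : framed st r -> computes st r tdigits s 28.
Proof.
move=> fr; apply: (computes_conv bound_ge8
    (computes_mul bound_ge8 (computes_const c0) (computes_log bound_ge8
    (computes_order fr) _) _)) => //.
  by rewrite n_gt0 order_le_bound.
exact: leq_trans trunc_log_lt order_le_bound.
Qed.

Hypothesis q_gt0 : 0 < q.

Lemma computes_digit st r tx x tl l : framed st r -> computes st r tx x 1 -> x < M ^ s ->
  computes st r tl l 1 -> l < s -> computes st r (tdigit tx tl) (digit M x l) 148.
Proof.
move=> fr cx xM cl ls; have cM := computes_base fr.
have xB : x <= B by exact: leq_trans (ltnW xM) codes_le_bound.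
have lsB : l <= B by exact: leq_trans (ltnW ls) (digits_le_bound q_gt0).
apply: (computes_conv bound_ge8
    (computes_mod bound_ge8 (computes_div bound_ge8 cx
    (computes_pow bound_ge8 cM cl base_le_bound lsB) xB _) cM _ _)) => //.
- by rewrite expn_gt0 base_gt0 pow_le_bound// ltnW.
- by apply: leq_trans xB; exact: leq_div.
- by rewrite base_gt0 base_le_bound.
Qed.

Lemma computes_seed st r tx x (i : 'I_q) tv (v : 'I_n) : framed st r ->
  computes st r tx x 1 -> x < M ^ s -> computes st r tv v 1 ->
  computes st r (tseed tx i tv) (v \in seed n s x i) 400.
Proof.
move=> fr cx xM cv; rewrite inE.
apply: (computes_conv bound_ge8
    (computes_ex bound_ge8 (hf := 319) (computes_digits fr) (digits_le_bound q_gt0) _)) => //.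
move=> st' r' tl l le ag cl; have fr' := framed_ext fr le ag.
apply: (computes_conv bound_ge8
    (computes_eqn bound_ge8 (computes_digit fr' (computes_weaken cx le ag) xM cl (ltn_ord l))
  (computes_add bound_ge8 (computes_mul bound_ge8 (computes_const i)
      (computes_order fr') order_le_bound) (computes_weaken cv le ag)))) => //.
Qed.

Lemma heap_input (u v : 'I_n) : heap (input G) (u * n + v) = adj G u v.
Proof.
rewrite /=; congr nat_of_bool; apply/existsP/idP => [[u' /existsP[v' /andP[/eqP e]]]|uv].
  by have [/val_inj -> ->] := code_inj e.
by exists u; apply/existsP; exists v; rewrite eqxx.
Qed.

Lemma computes_adj st r tu (u : 'I_n) tv (v : 'I_n) : framed st r ->
  computes st r tu u 1 -> computes st r tv v 1 ->
  computes st r (tadj tu tv) (adj G u v) 11.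
Proof.
move=> fr cu cv.
apply: (computes_conv bound_ge8
    (computes_read bound_ge8 (computes_add bound_ge8 (computes_mul bound_ge8 cu
    (computes_order fr) order_le_bound) cv))) => //.
by case: fr => _ _ ->; rewrite heap_input.
Qed.

Lemma computes_cnt st r tx x (i : 'I_q) tu (u : 'I_n) : framed st r ->
  computes st r tx x 1 -> x < M ^ s -> computes st r tu u 1 ->
  computes st r (tcnt tx i tu) (cnt G u (seed n s x i)) 420.
Proof.
move=> fr cx xM cu.
apply: (computes_conv bound_ge8
    (computes_sum bound_ge8 (hf := 412) (f
    := fun w => adj G u w && (w \in seed n s x i))
    (computes_order fr) order_le_bound _)) => //.
  move=> st' r' tw w le ag cw; have fr' := framed_ext fr le ag.
  apply: (computes_conv bound_ge8
      (computes_and bound_ge8 (computes_adj fr' (computes_weaken cu le ag) cw)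
      (fun _ => computes_seed i fr' (computes_weaken cx le ag) xM cw))) => //.
rewrite /cnt -sum1_card [RHS]big_mkcond; apply: eq_bigr => w _ /=.
by rewrite !inE; case: (adj G u w && _).
Qed.

Lemma computes_check st r tx x : framed st r -> computes st r tx x 1 -> x < M ^ s ->
  computes st r (tcheck tx) (good_seed D d G (seed n s x)) hcheck.
Proof.
move=> fr cx xM; rewrite /good_seed; apply: (computes_all bound_ge8
    (computes_order fr) order_le_bound).
move=> st1 r1 tv v le1 ag1 cv; have fr1 := framed_ext fr le1 ag1.
have {}cx := computes_weaken cx le1 ag1.
apply: computes_exc; first exact: bound_ge8.
move=> i; apply: computes_and; first exact: bound_ge8.
  apply: computes_allc; first exact: bound_ge8.
  move=> j; apply: (computes_conv bound_ge8
      (computes_lookup bound_ge8 (fun t => `[< D i j t >] : nat) d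
      (computes_cnt j fr1 cx xM cv))) => //.
  nia.
move=> _; apply: computes_and; first exact: bound_ge8.
  apply: (computes_allc bound_ge8 (hf := 401)).
  move=> j; case: ifP => ji /=; last exact: (computes_conv bound_ge8 (computes_const 1)).
  by apply: (computes_conv bound_ge8 (computes_not bound_ge8 (computes_seed j fr1 cx xM cv))).
move=> _; apply: computes_or; [exact: bound_ge8|exact: computes_seed|].
apply: (computes_conv bound_ge8
    (computes_all (hf := 436) bound_ge8 (computes_order fr1) order_le_bound _)) => //.
move=> st2 r2 tu u le2 ag2 cu; have fr2 := framed_ext fr1 le2 ag2.
rewrite implybE.
by apply: (computes_conv bound_ge8
    (computes_or bound_ge8 (computes_not bound_ge8 (computes_adj fr2
    (computes_weaken cv le2 ag2) cu))
  (computes_le bound_ge8 (computes_const d) (computes_cnt i fr2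
      (computes_weaken cx le2 ag2) xM cu)))).
Qed.

Lemma computes_answer st r : framed st r ->
  computes st r tanswer [exists x : 'I_(M ^ s), good_seed D d G (seed n s x)] (46 + hcheck + 7).
Proof.
move=> fr; apply: (computes_ex bound_ge8 _ codes_le_bound).
  apply: (computes_conv bound_ge8
      (computes_pow bound_ge8 (computes_base fr)
      (computes_digits fr) base_le_bound (digits_le_bound q_gt0))) => //.
move=> st' r' tx x le ag cx; apply: computes_check (ltn_ord x) => //.
exact: framed_ext le ag.
Qed.

Lemma program_run : exists t st, [/\ exec program (input G) t st, t <= B ^ hprogram &
  (reg st 0 != 0) = [exists x : 'I_(M ^ s), good_seed D d G (seed n s x)]].
Proof.
have fr : framed (input G) 1 by split.
have [t [st [ex le v ag]]] := computes_answer fr (leqnn 1) (agree_refl _ _).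
(* Copying the answer to register 0 takes 2 more steps. *)
exists (t + 2), (set_reg (set_reg st 0 0) 0 (reg st 1)); split.
- by apply: exec_seq ex _; exact: exec_ccopy.
- have -> : hprogram = 46 + hcheck + 7 + 0 + 1 by rewrite /hprogram; lia.
  apply: (leq_trans _ (expD2 bound_ge8 (46 + hcheck + 7) 0 (isT : 1 <= 6))).
  by rewrite expn0 -addnA leq_add2r.
- by rewrite reg_upd v; case: existsP.
Qed.

End Run.

Hypothesis Dd : forall i j, respects d (D i j).

(** The length of the codes is q times the size 3 d k of the seed of one class,
    where k = c1 (log n + 1) is the size of the excluded biholes. *)
Lemma program_correct c1 n (G : sgraph n) : 0 < q -> 0 < n ->
  c0 = q * (d * (3 * c1)) -> bihole_free (c1 * (trunc_log 2 n).+1) G ->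
  exists t st, [/\ exec program (input G) t st, t <= bound n ^ hprogram &
    (reg st 0 != 0) <-> has_Dpartition D G].
Proof.
move=> q0 n0 c0E free; have [t [st [ex le eqst]]] := program_run G n0 q0.
exists t, st; split=> //; rewrite eqst; split=> [/existsP[x]|[V DV]];
    first exact: good_seed_sound.
have SP i := small_seed d (V i) free.
have /fin_all_exists [S {}SP] := SP.
have [|x xM xS] := @exists_seed q n (c0 * (trunc_log 2 n).+1) S n0.
  apply: (@leq_trans (\sum_(i < q) d * (3 * (c1 * (trunc_log 2 n).+1)))).
    by apply: leq_sum => i _; have [] := SP i.
  by rewrite sum_nat_const card_ord c0E; lia.
apply/existsP; exists (Ordinal xM); rewrite /= xS.
by apply: (good_seed_complete Dd DV) => i; have [] := SP i.
Qed.

End Algorithm.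

End Program.

(** * Asymptotics *)

Local Open Scope classical_set_scope.
Local Open Scope ring_scope.

Section Asymptotics.
Variable R : realType.

Lemma exists_pow_le_eighth (x : R) : 0 < x -> x < 1 ->
  exists2 c : nat, (0 < c)%N & x ^+ c <= 8%:R^-1.
Proof.
move=> x0 x1.
have xn : `|x| < 1 by rewrite gtr0_norm.
have /cvgr0_norm_le := cvg_geometric (1 : R) xn.
move=> /(_ (8%:R^-1)); rewrite invr_gt0 ltr0n => /(_ isT)[N _ NP].
exists N.+1 => //; have := NP N.+1 (leqnSn N).
by rewrite /geometric /= mul1r normrX gtr0_norm.
Qed.

(** With L = log n + 1 one has n < 2 ^ L, so that the left-hand side is at most
    (4 ^ L * 8 ^ - L) ^ k, and 2 ^ - L is at most 1 / (n + 1). *)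
Lemma bihole_error (x : R) c1 n (k := (c1 * (trunc_log 2 n).+1)%N) :
  0 < x -> (0 < c1)%N -> x ^+ c1 <= 8%:R^-1 ->
  (n ^ (k + k))%:R * x ^+ (k * k) <= harmonic n.
Proof.
move=> x0 c10 xc; set L := (trunc_log 2 n).+1.
have k0 : (0 < k)%N by rewrite muln_gt0 c10.
have nL : (n < 2 ^ L)%N by exact: trunc_log_ltn.
apply: (@le_trans _ _ (((2 ^ L) ^ (k + k))%:R * (8%:R^-1) ^+ (L * k))).
  apply: ler_pM => //; first by rewrite exprn_ge0// ltW.
    by rewrite ler_nat; case: (k + k)%N => // m; rewrite leq_exp2r// ltnW.
  have -> : (k * k = c1 * (L * k))%N by rewrite {1}/k mulnA.
  by rewrite exprM lerXn2r// ?nnegrE ?exprn_ge0 ?invr_ge0// ltW.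
have -> : ((2 ^ L) ^ (k + k))%:R * (8%:R^-1) ^+ (L * k) = (2%:R^-1) ^+ (L * k) :> R.
  rewrite -expnM addnn -muln2 mulnA [(_ * 2)%N]mulnC expnM natrX -exprMn.
  by congr (_ ^+ _); field.
apply: (@le_trans _ _ ((2%:R^-1) ^+ L)).
  by rewrite ler_wiXn2l// ?invr_ge0 ?invf_le1 ?ler1n ?leq_pmulr.
by rewrite exprVn lef_pV2 ?posrE ?exprn_gt0// -natrX ler_nat.
Qed.

Lemma bound_trivial q n : bound q 0 n = (8 * (q.+1 * n))%N.
Proof. by rewrite /bound mul0n expn0 muln1. Qed.

Lemma bound_le q c0 n : (q < n)%N -> (8 <= n)%N ->
  (bound q c0 n <= n ^ (3 + 2 * (c0 * (trunc_log 2 n).+1)))%N.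
Proof.
move=> qn n8; rewrite /bound; move: (c0 * _)%N => s.
have Mn : (q.+1 * n <= n ^ 2)%N by rewrite -mulnn leq_mul2r qn orbT.
rewrite (_ : (3 + 2 * s = 1 + 2 + 2 * s)%N)// (expnD n (1 + 2)) (expnD n 1) expn1.
apply: leq_mul; first exact: leq_mul.
by rewrite expnM; case: s => // s; rewrite leq_exp2r.
Qed.

Lemma trunc_log_ge_near N : \forall n \near \oo, (N <= trunc_log 2 n)%N.
Proof.
near=> n; apply: trunc_log_max => //.
by near: n; exact: nbhs_infty_ge.
Unshelve. all: by end_near. Qed.

(** The exponent on the left is of order log^2 n after writing n <= 2 ^ (log n + 1);
    the fourth power of the logarithm outgrows it whatever K is, which is why
    the constant in the exponent can be 1. *)
Lemma quasipoly_le (K m : nat) : (0 < m)%N ->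
  \forall n \near \oo, (n ^ (K * (trunc_log 2 n).+1))%:R
     <= 2 `^ (m%:R * ln n%:R ^+ 4) :> R.
Proof.
move=> m0; pose a : R := ln 2.
have a0 : 0 < a by rewrite ln_gt0// ltr1n.
(* log n >= N gives 4 K <= a ^ 4 log n, hence 4 K log^2 n <= (a log n) ^ 4. *)
pose N := (Num.bound ((a ^+ 4)^-1 * (4 * K%:R))).+1.
near=> n.
have Nn : (N <= trunc_log 2 n)%N by near: n; exact: trunc_log_ge_near.
have n0 : (0 < n)%N by rewrite lt0n; apply/eqP => n0; move: Nn; rewrite n0 trunc_log0.
set l := trunc_log 2 n in Nn *.
have l1 : (1 <= l)%N by exact: leq_trans Nn.
have lna : a * l%:R <= ln n%:R.
  rewrite mulr_natr -lnXn// -natrX ler_ln ?posrE ?ltr0n ?expn_gt0//.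
  by rewrite ler_nat; exact: trunc_logP.
have Kl : 4 * K%:R <= a ^+ 4 * l%:R.
  rewrite -ler_pdivrMl ?exprn_gt0//.
  apply: ltW; apply: (lt_le_trans (archi_boundP _)).
    by rewrite mulr_ge0 ?mulr_ge0// invr_ge0 exprn_ge0// ltW.
  by rewrite ler_nat; apply: ltnW.
apply: (@le_trans _ _ ((2 ^ l.+1) ^ (K * l.+1))%:R).
  rewrite ler_nat; case: (K * _)%N => // j; rewrite leq_exp2r//.
  by apply: ltnW; exact: trunc_log_ltn.
rewrite -expnM natrX -[leLHS]powR_mulrn// ler_powR ?ler1n//.
apply: (@le_trans _ _ (ln n%:R ^+ 4)); last first.
  by rewrite ler_peMl ?ler1n// exprn_ge0// (le_trans _ lna)// mulr_ge0// ltW.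
apply: (@le_trans _ _ ((a * l%:R) ^+ 4)); last first.
  by rewrite lerXn2r// nnegrE ?(le_trans _ lna)// mulr_ge0// ltW.
have l1R : 1 <= l%:R :> R by rewrite ler1n.
rewrite !natrM -[l.+1%:R]natr1 exprMn.
have h1 : (l%:R + 1) * (K%:R * (l%:R + 1)) <= 4 * K%:R * l%:R ^+ 2 :> R.
  have K0 : 0 <= K%:R :> R by [].
  have : (l%:R + 1) * (l%:R + 1) <= 4 * l%:R ^+ 2 :> R by nra.
  by move=> /(ler_wpM2l K0); lra.
apply: (le_trans h1).
apply: (@le_trans _ _ (a ^+ 4 * l%:R * l%:R ^+ 2)).
  by rewrite ler_wpM2r// exprn_ge0.
rewrite -mulrA -exprS ler_wpM2l ?exprn_ge0 ?(ltW a0)//.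
by rewrite ler_weXn2l.
Unshelve. all: by end_near. Qed.

(** When d = 0 the exponential factor is 1, and the bound must be polynomial:
    it is, because codes of length 0 leave a single seed to try. *)
Lemma O_star_bound (q c0 h d : nat) : (0 < q)%N -> (d = 0%N -> c0 = 0%N) ->
  O_star (fun n => (bound q c0 n ^ h)%:R : R)
    (fun n => 2 `^ (1 * (q * d)%:R * ln n%:R ^+ 4)).
Proof.
move=> q0; case: d => [|d] c00.
  rewrite (c00 erefl) {c00}; exists h; apply/eqO_exP.
  exists ((8 * q.+1) ^ h)%:R; first by rewrite ltr0n expn_gt0 muln_gt0.
  near=> n; rewrite muln0 mulr0 mul0r powRr0 mulr1.
  rewrite !ger0_norm ?exprn_ge0// bound_trivial mulnA expnMn.
  by rewrite natrM [(n ^ h)%:R]natrX.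
exists 0%N; apply/eqO_exP; exists 1 => //.
have quasi := quasipoly_le ((3 + 2 * c0) * h) (isT : (0 < q.-1.+1 * d.+1)%N).
rewrite prednK// in quasi.
near=> n; rewrite expr0 !mul1r ger0_norm// ger0_norm ?powR_ge0//.
have qn : (q < n)%N by near: n; exact: nbhs_infty_gt.
have n8 : (8 <= n)%N by near: n; exact: nbhs_infty_ge.
apply: (@le_trans _ _ (n ^ ((3 + 2 * c0) * h * (trunc_log 2 n).+1))%:R).
  rewrite ler_nat; apply: (@leq_trans ((n ^ (3 + 2 * (c0 * (trunc_log 2 n).+1))) ^ h)%N).
    by have [->//|h0] := posnP h; rewrite leq_exp2r// bound_le.
  by rewrite -expnM leq_pexp2l//; [lia|nia].
by near: n.
Unshelve. all: by end_near. Qed.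

End Asymptotics.

Theorem corollary3 (R : realType) (p : R) (p_gt0 : 0 < p) (p_lt1 : p < 1) :
  exists c : R, forall (q : nat) (q_ge1 : (1 <= q)%N) (D : 'M[set nat]_q),
    (forall i j, fin_or_cofin (D i j)) ->
    exists (A : cmd) (T : nat -> R),
      O_star T (fun n => 2 `^ (c * (q * dmx D)%:R * ln n%:R ^+ 4)) /\
      almost_surely_solves p D A T.
Proof.
have np0 : 0 < 1 - p by rewrite subr_gt0.
have np1 : 1 - p < 1 by rewrite ltrBlDr ltrDl.
have [c1 c1_gt0 c1P] := exists_pow_le_eighth np0 np1.
exists 1 => q q_ge1 D finD.
pose d := dmx D; pose c0 := (q * (d * (3 * c1)))%N.
exists (program d c0 D), (fun n => (bound q c0 n ^ hprogram q d)%:R); split.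
  by apply: O_star_bound => // d0; rewrite /c0 /d d0 mul0n muln0.
apply: (@squeeze_cvgr _ _ _ _ (fun n => 1 - harmonic n) (fun=> 1)).
- near=> n; rewrite gnp_prob_le1// andbT.
  have n0 : (0 < n)%N by near: n; exact: nbhs_infty_gt.
  pose k := (c1 * (trunc_log 2 n).+1)%N.
  apply: (@le_trans _ _ (1 - (n ^ (k + k))%:R * (1 - p) ^+ (k * k))).
    by rewrite lerD2l lerN2; exact: bihole_error.
  apply: (le_trans (gnp_bihole_free p_gt0 p_lt1 k n)).
  apply: gnp_prob_sub => // G free.
  have [t [s [ex le ans]]] := program_correct (dmx_respects finD) q_ge1 n0 (erefl c0) free.
  by exists t, s; split; rewrite ?ler_nat.
- by rewrite -[X in _ --> X]subr0; apply: cvgB; [exact: cvg_cst|exact: cvg_harmonic].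
- exact: cvg_cst.
Unshelve. all: by end_near. Qed.
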